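(* Let $m>1$, $\theta>1$, $\lambda\in\mathbb{R}$ and $C_0>0$. Let $v\in C([0,T);L^1_{loc}(\Omega))$ be nonnegative, with $v_0=v(\cdot,0)\in L^r(\Omega)$ for some $r\ge 1$ such that $$r>\theta'(1-m-\lambda).$$ For $\alpha\ge 0$ set $\beta=\beta(\alpha)=1+(\alpha+\lambda)/m$, and consider, for $0\le s<t<T$, the inequality $$(\ast)\qquad \frac{1}{\alpha+1}\int_\Omega v^{\alpha+1}(\cdot,t)\,dx+\frac{C_0}{\beta^m}\int_s^t\Big(\int_\Omega v^{\beta m\theta}(\cdot,\tau)\,dx\Big)^{\frac1\theta}d\tau\le \frac{1}{\alpha+1}\int_\Omega v^{\alpha+1}(\cdot,s)\,dx,$$ where the right-hand side can be infinite. If $r>1$, assume that $(\ast)$ holds for any $0\le s<t<T$ and any $\alpha\ge r-1$. If $r=1$, assume one of the two following conditions: (H$_1$) $(\ast)$ holds for any $0\le s<t<T$ and any $\alpha\ge 0$; (H$_2$) $\int_\Omega v(\cdot,t)\,dx\le\int_\Omega v_0\,dx$ for any $t\in(0,T)$, and $v_0\in L^\rho(\Omega)$ for some $\rho>1$ such that $\rho\,\theta'(1-m-\lambda)<1$, and $(\ast)$ holds for any $0\le s<t<T$ and any $\alpha\ge\rho-1$. Then there exists $C>0$, depending only on $N,m,r,\lambda,\theta,C_0$, and possibly $\rho$, such that for any $t\in(0,T)$, $$\|v(\cdot,t)\|_{L^\infty(\Omega)}\le C\,t^{-\sigma_{r,m,\lambda,\theta}}\,\|v_0\|_{L^r(\Omega)}^{\varpi_{r,m,\lambda,\theta}},$$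 where $$\sigma_{r,m,\lambda,\theta}=\frac{1}{\frac{r}{\theta'}+\lambda+m-1}=\frac{\theta'}{r}\,\varpi_{r,m,\lambda,\theta}.$$
   Context: $\Omega=\mathbb{R}^N$ or $\Omega$ is a smooth bounded domain of $\mathbb{R}^N$; $T\in(0,\infty]$. For $\theta>1$, $\theta'=\theta/(\theta-1)$. *)

(* Defs.v *)
From HB Require Import structures.
From mathcomp Require Import all_boot all_order all_algebra.
From mathcomp Require Import all_classical all_reals all_analysis.
From mathcomp Require Import measurable_realfun ess_sup_inf.

Set Implicit Arguments.
Unset Strict Implicit.
Unset Printing Implicit Defensive.
Import Order.TTheory GRing.Theory Num.Theory.
Import numFieldNormedType.Exports.
Local Open Scope classical_set_scope.
Local Open Scope ring_scope.

(* The Borel sigma-algebra on R^n, generated by the open sets of the (sup-norm)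
   topology of 'rV[R]_n. *)
Definition rV_display : measure_display.
Proof. exact. Qed.

Section borel_rV.
Context {R : realType} (n : nat).

Definition borel_rV : set (set 'rV[R]_n) := <<s [set A : set 'rV[R]_n | open A] >>.

Let borel_rV0 : borel_rV set0.
Proof. exact: sigma_algebra0. Qed.

Let borel_rVC A : borel_rV A -> borel_rV (~` A).
Proof. exact: sigma_algebraC. Qed.

Let borel_rV_bigcup (F : (set 'rV[R]_n)^nat) :
  (forall i, borel_rV (F i)) -> borel_rV (\bigcup_i F i).
Proof. exact: sigma_algebra_bigcup. Qed.

HB.instance Definition _ := @isMeasurable.Build rV_display 'rV[R]_n
  borel_rV borel_rV0 borel_rVC borel_rV_bigcup.

Lemma open_measurable_rV (A : set 'rV[R]_n) : open A -> measurable A.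
Proof. by move=> oA; exact: sub_sigma_algebra. Qed.

Lemma open_rV_bigcup_ball (A : set 'rV[R]_n) : open A ->
  exists D : set ('rV[rat]_n * nat), A =
    \bigcup_(i in D) ball (map_mx ratr i.1 : 'rV[R]_n) i.2.+1%:R^-1.
Proof.
move=> oA.
exists [set i | ball (map_mx ratr i.1 : 'rV[R]_n) i.2.+1%:R^-1 `<=` A].
apply/seteqP; split=> [x Ax|x [i /= iA]]; last exact: iA.
have /nbhs_ballP[e /= e0 eA] : nbhs x A by exact: open_nbhs_nbhs.
have [k ke] : exists k : nat, k.+1%:R^-1 < e / 2.
  have e20 : 0 < (e / 2)^-1 by rewrite invr_gt0 divr_gt0.
  exists (Num.bound (e / 2)^-1).
  rewrite invf_plt ?posrE ?divr_gt0//.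
  rewrite (lt_le_trans (archi_boundP (ltW e20)))// ler_nat//.
have k0 : (0:R) < k.+1%:R^-1 by rewrite invr_gt0.
have qP i : exists q : rat, `|ratr q - x ord0 i : R| < k.+1%:R^-1.
  have : x ord0 i - k.+1%:R^-1 < x ord0 i + k.+1%:R^-1.
    by rewrite ltrD2l gt0_cp.
  case/rat_in_itvoo => q; rewrite in_itv /= => /andP[q1 q2].
  by exists q; rewrite ltr_distl q1 q2.
pose q : 'rV[rat]_n := \row_i projT1 (cid (qP i)).
have bq : ball (map_mx ratr q : 'rV[R]_n) k.+1%:R^-1 x.
  split => // i j; rewrite !ord1 !mxE /ball /=.
  by case: cid.
exists (q, k) => //= y bqy; apply: eA.
rewrite (splitr e); apply: (@ball_triangle _ _ (map_mx ratr q : 'rV[R]_n)).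
  by apply: ball_sym; apply: le_ball bq; exact: ltW.
by apply: le_ball bqy; exact: ltW.
Qed.

End borel_rV.

Section lebesgue_rV.
Context {R : realType}.

(* (a, (x_1, .., x_n)) |-> (a, x_1, .., x_n) *)
Definition cons_rV (n : nat) (p : measurableTypeR R * 'rV[R]_n) : 'rV[R]_n.+1 :=
  \row_i if unlift ord0 i is Some j then p.2 ord0 j else p.1.

Definition uncons_rV (n : nat) (x : 'rV[R]_n.+1) : measurableTypeR R * 'rV[R]_n :=
  (x ord0 ord0, \row_j x ord0 (lift ord0 j)).

Lemma uncons_rVK (n : nat) : cancel (@uncons_rV n) (@cons_rV n).
Proof.
by move=> x; apply/rowP => i; rewrite mxE; case: unliftP => [j|] -> //=; rewrite mxE.
Qed.

Lemma cons_rVK (n : nat) : cancel (@cons_rV n) (@uncons_rV n).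
Proof.
move=> [a x]; rewrite /uncons_rV mxE unlift_none; congr pair.
by apply/rowP => j; rewrite !mxE liftK.
Qed.

Lemma measurable_cons_rV (n : nat) : measurable_fun setT (@cons_rV n).
Proof.
apply: (@measurability _ _ _ _ _ _ [set A : set 'rV[R]_n.+1 | open A]) => //.
move=> _ [A /open_rV_bigcup_ball [D ->] <-].
rewrite setTI preimage_bigcup bigcup_mkcond.
apply: countable_bigcupT_measurable => [|i]; first exact: countableP.
case: ifPn => // _; have : (0 : R) < i.2.+1%:R^-1 by rewrite invr_gt0.
move: (i.2.+1%:R^-1 : R) => e egt0.
set c := map_mx _ _.
rewrite (_ : _ @^-1` _ = (ball (c ord0 ord0) e : set (measurableTypeR R)) `*`
    (ball (uncons_rV c).2 e : set 'rV[R]_n)).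
  apply: measurableX.
    by apply: open_measurable; exact: ball_open.
  by apply: open_measurable_rV; exact: ball_open.
apply/seteqP; split=> -[x y] /=.
  move=> [e0 H]; split.
    by have := H ord0 ord0; rewrite [X in ball _ _ X]mxE unlift_none.
  split=> // k j; have := H k (lift ord0 j).
  by rewrite [X in ball _ _ X]mxE liftK /= !ord1 [X in _ -> ball X _ _]mxE.
move=> [bx [e0 by_]]; split=> // k j; rewrite ord1 [X in ball _ _ X]mxE.
case: unliftP => [l|] -> //.
by have := by_ ord0 l; rewrite [X in ball X _ _ -> _]mxE.
Qed.

Lemma measurable_coord_rV (n : nat) (i : 'I_n) :
  measurable_fun setT (fun x : 'rV[R]_n => x ord0 i : measurableTypeR R).
Proof.
apply: (measurability _ (RGenOpens.measurableE R)).
move=> _ [_ [a [b ->] <-]]; rewrite setTI; apply: open_measurable_rV.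
by apply: open_comp; [move=> x _; exact: coord_continuous|exact: interval_open].
Qed.

Lemma measurable_uncons_rV (n : nat) : measurable_fun setT (@uncons_rV n).
Proof.
apply: measurable_fun_pair; first exact: measurable_coord_rV.
apply: (@measurability _ _ _ _ _ _ [set A : set 'rV[R]_n | open A]) => //.
move=> _ [A oA <-]; rewrite setTI; apply: open_measurable_rV.
apply: open_comp => // x _.
move=> B /nbhs_ballP[e /= e0 eB]; apply/nbhs_ballP; exists e => //= z [_ xz].
by apply: eB; split=> // i j; rewrite !mxE; exact: xz.
Qed.

Section lebesgue_succ.
Variables (n : nat) (mu : {sigma_finite_measure set 'rV[R]_n -> \bar R}).
Local Open Scope ereal_scope.

Definition lebesgue_rVS : set 'rV[R]_n.+1 -> \bar R :=
  pushforward (@lebesgue_measure R \x mu) (@cons_rV n).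

Let lebesgue_rVS0 : lebesgue_rVS set0 = 0.
Proof. by rewrite /lebesgue_rVS /pushforward preimage_set0 measure0. Qed.

Let lebesgue_rVS_ge0 A : 0 <= lebesgue_rVS A.
Proof. by rewrite /lebesgue_rVS /pushforward measure_ge0. Qed.

Let lebesgue_rVS_sigma_additive : semi_sigma_additive lebesgue_rVS.
Proof.
move=> F mF tF mUF; rewrite /lebesgue_rVS /pushforward preimage_bigcup.
have mcons A : measurable A -> measurable (@cons_rV n @^-1` A).
  by move=> mA; rewrite -[X in measurable X]setTI; exact: measurable_cons_rV.
apply: measure_semi_sigma_additive; first by move=> k; exact: mcons.
- apply/trivIsetP => /= i j _ _ ij; rewrite -preimage_setI.
  by move/trivIsetP : tF => /(_ _ _ _ _ ij) ->//; rewrite preimage_set0.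
- by rewrite -preimage_bigcup; exact: mcons.
Qed.

HB.instance Definition _ := isMeasure.Build _ _ _ lebesgue_rVS
  lebesgue_rVS0 lebesgue_rVS_ge0 lebesgue_rVS_sigma_additive.

Let lebesgue_rVS_sigma_finite : sigma_finite setT lebesgue_rVS.
Proof.
have /sigma_finiteP[F [TF ndF Foo]] := sigma_finiteT (@lebesgue_measure R).
have /sigma_finiteP[G [TG ndG Goo]] := sigma_finiteT mu.
exists (fun i => @uncons_rV n @^-1` (F i `*` G i)).
  rewrite -preimage_bigcup; apply/esym; rewrite -subTset => x _ /=.
  have [k _ Fk] : (\bigcup_i F i) (uncons_rV x).1 by rewrite -TF.
  have [l _ Gl] : (\bigcup_i G i) (uncons_rV x).2 by rewrite -TG.
  exists (maxn k l) => //; split => /=.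
    by move: Fk; apply/subsetPset/ndF; exact: leq_maxl.
  by move: Gl; apply/subsetPset/ndG; exact: leq_maxr.
move=> i; have [mF Fi] := Foo i; have [mG Gi] := Goo i.
split.
  rewrite -[X in measurable X]setTI; apply: measurable_uncons_rV => //.
  exact: measurableX.
rewrite /lebesgue_rVS /pushforward -comp_preimage.
rewrite (_ : _ \o _ = id); last by apply/funext => x /=; rewrite cons_rVK.
by rewrite preimage_id product_measure1E// lte_mul_pinfty// ge0_fin_numE.
Qed.

HB.instance Definition _ := @Measure_isSigmaFinite.Build _ _ _ lebesgue_rVS
  lebesgue_rVS_sigma_finite.

End lebesgue_succ.

(* Lebesgue measure on R^n, as an iterated product; it is determined by
   [lebesgue_rV_rectangle] below. *)
Fixpoint lebesgue_rV (n : nat) : {sigma_finite_measure set 'rV[R]_n -> \bar R} :=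
  match n with
  | 0 => \d_ (0 : 'rV[R]_0)
  | n'.+1 => lebesgue_rVS (lebesgue_rV n')
  end.

Lemma lebesgue_rV_rectangle (n : nat) (A : 'I_n -> set (measurableTypeR R)) :
  (forall i, measurable (A i)) ->
  lebesgue_rV n [set x | forall i, A i (x ord0 i)] =
    (\prod_(i < n) lebesgue_measure (A i))%E.
Proof.
elim: n A => [|n IHn] A mA.
  by rewrite big_ord0 /= diracE mem_set// => -[].
rewrite big_ord_recl -IHn//.
have mB : measurable [set x : 'rV[R]_n | forall i, A (lift ord0 i) (x ord0 i)].
  rewrite (_ : mkset _ = \bigcap_(i in [set` 'I_n])
      ((fun x : 'rV[R]_n => x ord0 i) @^-1` A (lift ord0 i))); last first.
    by apply/seteqP; split => x /= xA i; [move=> _|]; exact: (xA i).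
  apply: fin_bigcap_measurable => // i _; rewrite -[X in measurable X]setTI.
  by apply: measurable_coord_rV.
rewrite -product_measure1E//=; congr (product_measure1 _ _ _).
apply/seteqP; split => -[a x] /=.
  move=> H; split => [|i].
    by have := H ord0; rewrite mxE unlift_none.
  by have := H (lift ord0 i); rewrite mxE liftK.
by move=> [H0 H1] i; rewrite mxE; case: unliftP => [j|] ->.
Qed.

End lebesgue_rV.

Section function_spaces.
Context {R : realType} (n : nat).
Implicit Types (Omega U : set 'rV[R]_n) (f : 'rV[R]_n -> R) (T : \bar R)
  (v : R -> 'rV[R]_n -> R).
Local Notation mu := (@lebesgue_rV R n).

(* C^oo on the open set U: all iterated partial derivatives exist and are
   continuous on U. *)
Definition smooth_on U f : Prop :=
  forall (s : seq 'I_n) (x : 'rV[R]_n), U x ->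
    let g := foldr (fun i h => 'D_(delta_mx ord0 i) h) f s in
    {for x, continuous g} /\ forall i, derivable g x (delta_mx ord0 i).

(* Near each boundary point, Omega lies on one side of a C^oo hypersurface,
   i.e. it is a sublevel set of a C^oo function with nonzero gradient. *)
Definition smooth_bounded_domain Omega : Prop :=
  [/\ open Omega, connected Omega, Omega !=set0, bounded_set Omega &
      forall x, (closure Omega `\` Omega) x ->
        exists U f, [/\ open U, U x, smooth_on U f,
          exists i, 'D_(delta_mx ord0 i) f x != 0 &
          Omega `&` U = [set y | U y /\ f y < 0]] ].

(* L^p(Omega) norm, p = +oo included, of the extension of f by 0. *)
Definition Lp_norm Omega (p : \bar R) f : \bar R :=
  Lnorm mu p ((EFin \o f) \_ Omega).

Definition in_Lp Omega (p : \bar R) f : Prop :=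
  measurable_fun Omega f /\ (Lp_norm Omega p f < +oo)%E.

Definition in_L1loc Omega f : Prop :=
  measurable_fun Omega f /\
  forall K, K `<=` Omega -> compact K -> (\int[mu]_(x in K) `|f x|%:E < +oo)%E.

(* v in C([0,T); L^1_loc(Omega)), for the seminorms given by the integrals over
   the compact subsets of Omega; v t is a representative of v(.,t), and its
   values for t outside [0,T) or x outside Omega are irrelevant. *)
Definition continuous_L1loc Omega T v : Prop :=
  forall t : R, 0 <= t -> (t%:E < T)%E ->
    in_L1loc Omega (v t) /\
    forall K, K `<=` Omega -> compact K ->
      (fun s => \int[mu]_(x in K) `|v s x - v t x|%:E)%E
        @ within [set s : R | 0 <= s /\ (s%:E < T)%E] (nbhs t) --> 0%E.

Definition ae_nonneg Omega T v : Prop :=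
  forall t : R, 0 <= t -> (t%:E < T)%E ->
    {ae mu, forall x, Omega x -> 0 <= v t x}.

(* The inequality is between extended real numbers: both sides may be +oo. *)
Definition energy_ineq Omega (m theta lambda C0 alpha : R) v (s t : R) : Prop :=
  let beta := 1 + (alpha + lambda) / m in
  ((alpha + 1)^-1%:E * \int[mu]_(x in Omega) (v t x `^ (alpha + 1))%:E
   + (C0 / beta `^ m)%:E *
     \int[lebesgue_measure]_(tau in `[s, t])
       (\int[mu]_(x in Omega) (v tau x `^ (beta * m * theta))%:E) `^ theta^-1
   <= (alpha + 1)^-1%:E * \int[mu]_(x in Omega) (v s x `^ (alpha + 1))%:E)%E.

Definition energy_ineq_above Omega T (m theta lambda C0 alpha0 : R) v : Prop :=
  forall s t alpha : R, 0 <= s -> s < t -> (t%:E < T)%E -> alpha0 <= alpha ->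
    energy_ineq Omega m theta lambda C0 alpha v s t.

End function_spaces.

Section exponents.
Context {R : realType}.
Implicit Types r m lambda theta : R.

Definition conj_exp theta : R := theta / (theta - 1).

Definition sigma_exp r m lambda theta : R :=
  (r / conj_exp theta + lambda + m - 1)^-1.

(* i.e. sigma = (theta' / r) * varpi *)
Definition varpi_exp r m lambda theta : R :=
  r / conj_exp theta * sigma_exp r m lambda theta.

End exponents.

Definition smoothing_estimate {R : realType} (n : nat) (Omega : set 'rV[R]_n)
    (T : \bar R) (m theta lambda r C : R) (v : R -> 'rV[R]_n -> R) : Prop :=
  forall t : R, 0 < t -> (t%:E < T)%E ->
    (Lp_norm Omega +oo (v t) <=
     (C * t `^ (- sigma_exp r m lambda theta))%:E *
     Lp_norm Omega r%:E (v 0%R) `^ varpi_exp r m lambda theta)%E.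

(* Main.v *)
Require Import Defs.
From mathcomp Require Import all_boot all_order all_algebra.
From mathcomp Require Import all_classical all_reals all_analysis.
From mathcomp Require Import measurable_realfun ess_sup_inf.
From mathcomp Require Import ring lra.

Import Order.TTheory GRing.Theory Num.Theory.
Import numFieldNormedType.Exports.
Local Open Scope classical_set_scope.
Local Open Scope ring_scope.

(** The proof is a Moser iteration in time.  Write A p t for the integral of
|v(.,t)|^p over Omega, kappa = m - 1 + lambda, and let pc = - theta' kappa be
the fixed point of the map p |-> theta (p + kappa).  The energy inequality for
the exponent p = alpha + 1 says two things.  Its first term shows that A p is
nonincreasing in time.  Its second term involves A q with
q = theta (p + kappa), and p < q exactly because p > pc; as A q is itself
nonincreasing, the time integral is at least (t - s) (A q t)^(1/theta), so that
A q t <= (c (A p s) / (t - s))^theta: a bound on a lower moment at an earlier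
time gives one on a higher moment at a later time ([moment_gain]).

Starting from p_0 = r, the exponents are p_k = pc + theta^k (r - pc), and they
are used at the times t (1 - 2^-k).  On the level of logarithms the recursion
reads y_(k+1) <= theta (y_k + b k + d), a linear recursion with an explicit
affine particular solution, hence ln A p_k t <= theta^k (y_0 + f) - f for an
explicit f depending on t through - theta' ln t ([moser_iteration]).  If |v(.,t)|
exceeded M on a set of positive measure c, then Chebyshev's inequality would
give p_k ln M + ln c <= theta^k (y_0 + f) - f for all k, and comparing the
growth in theta^k yields (r - pc) ln M <= y_0 + f, which is the estimate
([moser_bound]).

When r = 1 and the energy inequality is only available for p >= rho > 1, the
same bound holds from L^rho to L^oo between the times t / 2 and t.  The
interpolation A rho <= |v|_oo^(rho - 1) A 1, with A 1 controlled by the mass of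
v_0, turns it into an inequality bounding |v(t)|_oo by a power of
|v(t / 2)|_oo.  Once the expected decay t^(- sigma) is factored out, the
logarithm of the prefactor undergoes an affine contraction of ratio
(rho - 1) / (rho - pc) < 1 ([profile_contraction]); iterating from the crude
bound given by v_0 in L^rho removes the dependence on the L^rho norm
([profile_bound]). *)

(** * Moments and essential bounds *)

Section moments.
Context {d} {X : measurableType d} {R : realType}.
Variables (mu : {measure set X -> \bar R}) (D : set X).
Hypothesis mD : measurable D.
Implicit Types (u : X -> R) (f g : X -> \bar R) (p M : R).

(** The absolute value matters: the real power of a negative base is 1. *)
Definition moment p u : \bar R := (\int[mu]_(x in D) (`|u x| `^ p)%:E)%E.

Definition ess_bounded M u : Prop := {ae mu, forall x, D x -> `|u x| <= M}.

Lemma moment_ge0 p u : (0 <= moment p u)%E.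
Proof. by apply: integral_ge0 => x _; rewrite lee_fin powR_ge0. Qed.

Lemma measurable_moment p u : measurable_fun D u ->
  measurable_fun D (fun x => (`|u x| `^ p)%:E).
Proof.
move=> mu_; apply/measurable_EFinP.
apply: (measurableT_comp (measurable_powR p)).
exact: measurableT_comp.
Qed.

Lemma moment_ae_nonneg p u : measurable_fun D u ->
  {ae mu, forall x, D x -> 0 <= u x} ->
  (\int[mu]_(x in D) (u x `^ p)%:E)%E = moment p u.
Proof.
move=> mf u0; apply: ae_eq_integral => //.
- apply/measurable_EFinP.
  exact: (measurableT_comp (measurable_powR p)).
- exact: measurable_moment.
- by apply: filterS u0 => x u0 Dx; rewrite ger0_norm// u0.
Qed.

(** The integral of a nonnegative function is a supremum over the simple
functions below it, so it is monotone without measurability.  This spares the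
measurability in time of the spatial integrals in the energy inequality. *)
Lemma le_integral_nonmeasurable f g :
  (forall x, D x -> 0 <= f x)%E -> (forall x, D x -> f x <= g x)%E ->
  (\int[mu]_(x in D) f x <= \int[mu]_(x in D) g x)%E.
Proof.
move=> f0 fg.
have g0 x : D x -> (0 <= g x)%E by move=> Dx; exact: le_trans (f0 _ Dx) (fg _ Dx).
rewrite !ge0_integralE//; apply: le_ereal_sup => _ [h hf <-]; exists h => //.
move=> x; apply: le_trans (hf x) _; rewrite !patchE; case: ifPn => //.
by rewrite inE; exact: fg.
Qed.

Lemma measurable_superlevel M u : measurable_fun D u ->
  measurable (D `&` [set x | (M < `|u x|)%R]).
Proof.
move=> mf; rewrite (_ : [set _ | _] = (Num.norm \o u) @^-1` `]M, +oo[%classic).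
  have mn : measurable_fun D (Num.norm \o u) by exact: measurableT_comp.
  exact: mn.
by apply/seteqP; split=> x /=; rewrite in_itv/= andbT.
Qed.

Lemma chebyshev_moment p M u : measurable_fun D u -> 0 <= p -> 0 <= M ->
  ((M `^ p)%:E * mu (D `&` [set x | (M < `|u x|)%R]) <= moment p u)%E.
Proof.
move=> mf p0 M0.
have mE := measurable_superlevel M u mf.
rewrite -integral_cst//; apply: (@le_trans _ _
    (\int[mu]_(x in D `&` [set x | (M < `|u x|)%R]) (`|u x| `^ p)%:E)%E).
  apply: ge0_le_integral => //.
  - by move=> x _; rewrite lee_fin powR_ge0.
  - by apply: measurable_funS (measurable_moment p u mf) => //; exact: subIsetl.
  - move=> x [_ /= Mx]; rewrite lee_fin ge0_ler_powR// ?nnegrE//.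
    exact: ltW.
apply: ge0_subset_integral => //; exact: measurable_moment.
Qed.

Lemma ess_bounded_null M u : measurable_fun D u ->
  mu (D `&` [set x | (M < `|u x|)%R]) = 0%E -> ess_bounded M u.
Proof.
move=> mf m0; exists (D `&` [set x | (M < `|u x|)%R]); split => //.
  exact: measurable_superlevel.
move=> x /= /not_implyP[Dx] /negP; rewrite -ltNge; exact.
Qed.

Lemma moment_interpolation p M u : measurable_fun D u -> 1 <= p -> 0 <= M ->
  ess_bounded M u -> (moment p u <= (M `^ (p - 1))%:E * moment 1 u)%E.
Proof.
move=> mf p1 M0 uM; rewrite -ge0_integralZl_EFin//; last 2 first.
- exact: measurable_moment.
- exact: powR_ge0.
apply: ae_ge0_le_integral => //.
- exact: measurable_moment.
- by move=> x _; rewrite mule_ge0// lee_fin powR_ge0.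
- by apply: measurable_funeM; exact: measurable_moment.
apply: filterS uM => x uM Dx; rewrite lee_fin powRr1//.
have [->|p_neq1] := eqVneq p 1; first by rewrite subrr powRr0 powRr1// mul1r.
have pgt1 : 0 < p - 1 by rewrite subr_gt0 lt_neqAle eq_sym p_neq1.
rewrite -mulr_powRB1//; last exact: lt_le_trans p1.
by rewrite mulrC ler_wpM2r// ge0_ler_powR ?nnegrE ?(ltW pgt1)// uM.
Qed.

End moments.

Section Lnorm_bounds.
Context {d} {X : measurableType d} {R : realType}.
Variables (mu : {measure set X -> \bar R}) (D : set X).
Implicit Types (u : X -> R) (r K M w : R).

Lemma Lnorm_moment r u : 0 < r ->
  (Lnorm mu r%:E ((EFin \o u) \_ D) `^ r = moment mu D r u)%E.
Proof.
move=> r0; rewrite poweR_Lnorm ?gt_eqF// /moment [RHS]integral_mkcond.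
apply: eq_integral => x _; rewrite !patchE; case: ifPn => // _.
by rewrite abse0 poweR0r// gt_eqF.
Qed.

Lemma Lnorm_oo_le M u : 0 <= M -> ess_bounded mu D M u ->
  (Lnorm mu +oo ((EFin \o u) \_ D) <= M%:E)%E.
Proof.
move=> M0 uM; rewrite unlock /=; case: ifPn => // _; apply/ess_supP.
apply: filterS uM => x uM; rewrite /= patchE; case: ifPn => [|_].
  by rewrite inE lee_fin; exact: uM.
by rewrite abse0 lee_fin.
Qed.

(** Bounds valid for every positive a above the moment also cover the case of a
vanishing initial datum, where logarithms are unavailable. *)
Lemma Lnorm_oo_le_power r K w u u0 : 0 < r -> 0 < K -> 0 < w ->
  (moment mu D r u0 < +oo)%E ->
  (forall a, 0 < a -> (moment mu D r u0 <= a%:E)%E ->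
     ess_bounded mu D (K * a `^ w) u) ->
  (Lnorm mu +oo ((EFin \o u) \_ D) <=
   K%:E * Lnorm mu r%:E ((EFin \o u0) \_ D) `^ (r * w))%E.
Proof.
move=> r0 K0 w0 Moo uK; rewrite poweRrM Lnorm_moment//.
move: (moment_ge0 mu D r u0) Moo uK.
case: (moment _ _ _ _) => [b b0 _ uK| |//]; last by rewrite ltxx.
have [bgt0|] := ltP 0 b.
  by apply: Lnorm_oo_le; rewrite ?mulr_ge0 ?powR_ge0 ?(ltW K0)//; exact: uK.
rewrite lee_fin in b0; move=> b0'.
have {b0 b0'} b0 : b = 0 by apply/eqP; rewrite eq_le b0'.
rewrite b0 poweR0r ?gt_eqF// mule0; apply/lee_addgt0Pr => e e0; rewrite add0e.
(* The value of a for which the bound K * a `^ w equals e. *)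
have e0K : 0 < e / K by rewrite divr_gt0.
have -> : e = K * ((e / K) `^ w^-1) `^ w.
  by rewrite -powRrM mulVf ?gt_eqF// powRr1 ?ltW// mulrCA divff ?mulr1// gt_eqF.
apply: Lnorm_oo_le; first by rewrite mulr_ge0 ?powR_ge0// ltW.
by apply: uK; rewrite ?b0 ?lee_fin ?powR_ge0// powR_gt0.
Qed.

End Lnorm_bounds.

(** * The Moser iteration *)

Section iteration.
Context {R : realType}.
Variables (T : \bar R) (m theta kappa C0 p0 : R) (A : R -> R -> \bar R).
Implicit Types (p s t tau y : R).

(** The energy inequality for alpha = p - 1, as a property of the moments
alone; kappa stands for m - 1 + lambda. *)
Definition moment_decay : Prop := forall s t p : R,
  0 <= s -> s < t -> (t%:E < T)%E -> p0 <= p ->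
  ((p^-1)%:E * A p t + (C0 / ((p + kappa) / m) `^ m)%:E *
     \int[lebesgue_measure]_(tau in `[s, t]) A (theta * (p + kappa)) tau `^ theta^-1
   <= (p^-1)%:E * A p s)%E.

(** The fixed point of p |-> theta * (p + kappa); since theta > 1, the map moves
every p above it further up. *)
Definition critical_exp : R := - conj_exp theta * kappa.

Hypothesis (m1 : 1 < m) (theta1 : 1 < theta) (C0_gt0 : 0 < C0) (p01 : 1 <= p0).
Hypothesis p0_crit : critical_exp < p0.
Hypothesis A_ge0 : forall p t, (0 <= A p t)%E.
Hypothesis decayA : moment_decay.

Let theta0 : 0 < theta. Proof. exact: lt_trans theta1. Qed.
Let thetaB1 : 0 < theta - 1. Proof. by rewrite subr_gt0. Qed.
Let m0 : 0 < m. Proof. exact: lt_trans m1. Qed.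

Lemma conj_exp_gt0 : 0 < conj_exp theta.
Proof. exact: divr_gt0. Qed.

Lemma next_exp_crit x :
  theta * (critical_exp + x + kappa) = critical_exp + theta * x.
Proof. by rewrite /critical_exp /conj_exp; field; rewrite gt_eqF. Qed.

Lemma lt_next_exp p : p0 <= p -> p < theta * (p + kappa).
Proof.
move=> p0p; rewrite -(subrKC critical_exp p) next_exp_crit ltrD2l.
by rewrite ltr_pMl// subr_gt0 (lt_le_trans p0_crit).
Qed.

Lemma exp_kappa_gt0 p : p0 <= p -> 0 < p + kappa.
Proof.
move=> p0p; rewrite -(pmulr_rgt0 _ theta0) (le_lt_trans _ (lt_next_exp p p0p))//.
by rewrite (le_trans _ p0p)// (le_trans _ p01).
Qed.

Lemma moment_antitone p s t : p0 <= p -> 0 <= s -> s <= t -> (t%:E < T)%E ->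
  (A p t <= A p s)%E.
Proof.
move=> p0p s0; rewrite le_eqVlt => /predU1P[->//|st] tT.
have pgt0 : 0 < p by rewrite (lt_le_trans _ p0p)// (lt_le_trans _ p01).
have pV0 : (0 < p^-1%:E)%E by rewrite lte_fin invr_gt0.
rewrite -(lee_pmul2l _ pV0)//; apply: le_trans (decayA s t p s0 st tT p0p).
rewrite leeDl// mule_ge0//; last by apply: integral_ge0 => *; exact: poweR_ge0.
by rewrite lee_fin divr_ge0 ?powR_ge0// ltW.
Qed.

(** The higher moment is nonincreasing, so its time integral is at least t - s
times its value at t.  The bounds are kept in logarithmic form, which includes
vanishing moments and makes the recursion linear. *)
Lemma moment_gain p s t y : p0 <= p -> 0 <= s -> s < t -> (t%:E < T)%E ->
  (A p s <= (expR y)%:E)%E ->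
  (A (theta * (p + kappa)) t <=
   (expR (theta * (y + m * ln ((p + kappa) / m) - ln C0 - ln p
                   - ln (t - s))))%:E)%E.
Proof.
move=> p0p s0 st tT Ay.
have pgt0 : 0 < p by rewrite (lt_le_trans _ p0p)// (lt_le_trans _ p01).
have pk0 := exp_kappa_gt0 p p0p.
have tBs : 0 < t - s by rewrite subr_gt0.
set q := theta * (p + kappa); set b := (p + kappa) / m.
have b0 : 0 < b by rewrite divr_gt0.
have bm0 : 0 < b `^ m by rewrite powR_gt0.
have low : ((C0 / b `^ m)%:E * (A q t `^ theta^-1 * (t - s)%:E)
    <= (p^-1 * expR y)%:E)%E.
  rewrite [leRHS]EFinM; apply: (@le_trans _ _ (p^-1%:E * A p s)%E); last first.
    by rewrite lee_pmul2l// ?lte_fin ?invr_gt0.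
  apply: le_trans (decayA s t p s0 st tT p0p); rewrite -/b -/q.
  apply: le_trans (leeDr _ _); last by rewrite mule_ge0// lee_fin invr_ge0 ltW.
  rewrite lee_pmul2l// ?lte_fin ?divr_gt0//.
  rewrite [leLHS](_ : _ = \int[lebesgue_measure]_(tau in `[s, t])
    cst (A q t `^ theta^-1) tau)%E.
    apply: le_integral_nonmeasurable => tau /=; rewrite in_itv/=;
      move=> /andP[stau taut].
      exact: poweR_ge0.
    apply: gt0_ler_poweR; rewrite ?invr_ge0 ?(ltW theta0)//;
      rewrite ?in_itv/= ?leey ?andbT//.
    apply: moment_antitone => //; last exact: le_trans stau.
    by rewrite (le_trans p0p)// ltW// lt_next_exp.
  by rewrite integral_cst//= lebesgue_measure_itv/= lte_fin st -EFinB.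
have -> : expR (theta * (y + m * ln b - ln C0 - ln p - ln (t - s))) =
    (p^-1 * expR y / ((C0 / b `^ m) * (t - s))) `^ theta.
  rewrite mulrC expRM; congr (_ `^ _).
  rewrite !expRD !expRN (mulrC m) expRM !lnK ?posrE//.
  by field; rewrite !gt_eqF.
move: low (A_ge0 q t); case: (A q t) => [x| |//]; last first.
  rewrite poweRyr ?invr_eq0 ?gt_eqF// gt0_mulye ?lte_fin// gt0_muley//.
  by rewrite lte_fin divr_gt0.
rewrite poweR_EFin -!EFinM !lee_fin => low x0.
rewrite -(powRr1 x0) -{1}(mulVf (lt0r_neq0 theta0)) powRrM.
apply: ge0_ler_powR; rewrite ?nnegrE ?powR_ge0 ?(ltW theta0)//.
  by rewrite !divr_ge0// ?mulr_ge0 ?divr_ge0 ?invr_ge0 ?expR_ge0 ?ltW.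
rewrite ler_pdivlMr ?mulr_gt0 ?invr_gt0// (le_trans _ low)//.
by rewrite le_eqVlt; apply/orP; left; apply/eqP; ring.
Qed.

(** The growth in k of the logarithm of the constant of the k-th step: theta^m
comes from the factor beta^m, and 2 from the halving of the time steps. *)
Definition moser_slope : R := m * ln theta + ln 2.

Lemma moser_slope_ge0 : 0 <= moser_slope.
Proof. by rewrite addr_ge0 ?mulr_ge0 ?ln_ge0 ?ler1n// ltW. Qed.

(** Chosen so that the k-th value of beta is at most theta^k times this. *)
Definition moser_width : R := (`|critical_exp| + p0 - critical_exp) / m.

(** With f = moser_const - theta' ln tau and g = theta' moser_slope, the affine
function k |-> - f - g k solves y_(k+1) = theta (y_k + moser_slope k + d), where
d = m ln moser_width - ln C0 + ln 2 - ln tau. *)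
Definition moser_const : R := conj_exp theta *
  (m * ln moser_width - ln C0 + ln 2 + moser_slope / (theta - 1)).

Definition moser_exp k : R := critical_exp + theta ^+ k * (p0 - critical_exp).

Definition moser_time s tau k : R := s + tau * (1 - 2^-1 ^+ k).

Lemma moser_expS k : moser_exp k.+1 = theta * (moser_exp k + kappa).
Proof. by rewrite /moser_exp next_exp_crit exprS mulrA. Qed.

Lemma le_moser_exp k : p0 <= moser_exp k.
Proof.
rewrite -{1}(subrKC critical_exp p0) lerD2l ler_peMl ?subr_ge0 ?(ltW p0_crit)//.
by rewrite exprn_ege1// ltW.
Qed.

Lemma moser_width_gt0 : 0 < moser_width.
Proof.
rewrite divr_gt0// -addrA ltr_wpDl// subr_gt0//.
Qed.

Lemma ln_moser_exp k :
  ln ((moser_exp k + kappa) / m) <= k%:R * ln theta + ln moser_width.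
Proof.
have tk0 : 0 < theta ^+ k by rewrite exprn_gt0.
rewrite mulr_natl -lnXn// -lnM ?posrE ?moser_width_gt0//.
have := exp_kappa_gt0 _ (le_moser_exp k) => pk0.
rewrite ler_ln ?posrE ?(mulr_gt0 tk0 moser_width_gt0) ?(divr_gt0 pk0 m0)//.
rewrite /moser_width mulrA ler_pM2r ?invr_gt0//.
rewrite -(ler_pM2l theta0) -moser_expS mulrA -exprS /moser_exp.
rewrite -addrA [leRHS]mulrDr lerD2r.
rewrite (le_trans (ler_norm _))// ler_peMl// exprn_ege1// ltW//.
Qed.

(** By induction on k: the difference between the logarithm of the moment and
the affine particular solution is multiplied by theta at each step. *)
Lemma moser_iteration s tau y k :
  0 <= s -> 0 < tau -> ((s + tau)%:E < T)%E ->
  (A p0 s <= (expR y)%:E)%E ->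
  let f := moser_const - conj_exp theta * ln tau in
  (A (moser_exp k) (moser_time s tau k) <=
   (expR (theta ^+ k * (y + f) - f - conj_exp theta * moser_slope * k%:R))%:E)%E.
Proof.
move=> s0 tau0 stauT Ay /=; set f := moser_const - _.
have h2 : 2^-1 < 1 :> R by rewrite invf_lt1// ltr1n.
have h20 : 0 < 2^-1 :> R by rewrite invr_gt0.
elim: k => [|k IHk].
  rewrite /moser_exp /moser_time !expr0 subrr mulr0 addr0 !mul1r subrKC.
  by rewrite mulr0 subr0 addrK.
rewrite moser_expS; apply: le_trans (moment_gain _ _ _ _ _ _ _ _ IHk) _.
- exact: le_moser_exp.
- rewrite addr_ge0// mulr_ge0 ?(ltW tau0)// subr_ge0.
  by rewrite exprn_ile1 ?(ltW h20) ?(ltW h2).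
- by rewrite ltrD2l ltr_pM2l// ltrD2l ltrN2 exprS gtr_pMl// exprn_gt0.
- apply: le_lt_trans stauT.
  by rewrite lee_fin lerD2l ger_pMr// gerBl exprn_ge0// ltW.
have -> : moser_time s tau k.+1 - moser_time s tau k = tau * 2^-1 ^+ k.+1.
  by rewrite /moser_time exprS; field.
(* The step is exact up to ln (moser_exp k) >= 0 and the bound on beta. *)
rewrite lee_fin ler_expR.
have := ln_moser_exp k; set lnp := ln (_ / m).
have lnpk : 0 <= ln (moser_exp k) by rewrite ln_ge0// (le_trans p01) ?le_moser_exp.
rewrite [ln (tau * _)]lnM ?posrE ?exprn_gt0// lnXn// lnV ?posrE// => lnp_le.
have /(ler_wpM2l (ltW m0)) := lnp_le.
rewrite -subr_ge0 => mlnp.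
rewrite -subr_ge0 [X in 0 <= X](_ : _ = theta *
    (m * (k%:R * ln theta + ln moser_width) - m * lnp + ln (moser_exp k))).
  exact: mulr_ge0 (ltW theta0) (addr_ge0 mlnp lnpk).
rewrite /f /moser_const /conj_exp /moser_slope exprS -[_ *+ _]mulr_natl -natr1.
by field; rewrite gt_eqF.
Qed.

End iteration.

(** * From moments to the essential bound *)

Lemma exprn_unbounded (R : realType) (x y : R) : 1 < x -> exists k, y < x ^+ k.
Proof.
move=> x1.
have xB1 : 0 < x - 1 by rewrite subr_gt0.
have bern k : k%:R * (x - 1) <= x ^+ k.
  elim: k => [|k IHk]; first by rewrite mul0r expr0.
  rewrite -natr1 mulrDl mul1r exprS.
  have : 1 <= x ^+ k by rewrite exprn_ege1// ltW.
  by nra.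
exists (Num.bound (`|y| / (x - 1))).
apply: lt_le_trans (bern _); rewrite -ltr_pdivrMr//.
apply: le_lt_trans (archi_boundP _); last by rewrite divr_ge0// ltW.
by rewrite ler_pM2r ?invr_gt0// ler_norm.
Qed.

Section smoothing.
Context {d} {X : measurableType d} {R : realType}.
Variables (mu : {measure set X -> \bar R}) (D : set X).
Hypothesis mD : measurable D.
Variables (T : \bar R) (m theta kappa C0 : R) (v : R -> X -> R).
Hypothesis (m1 : 1 < m) (theta1 : 1 < theta) (C0_gt0 : 0 < C0).
Hypothesis mv : forall t, 0 <= t -> (t%:E < T)%E -> measurable_fun D (v t).

Local Notation crit := (critical_exp theta kappa).
Local Notation A := (fun p t => moment mu D p (v t)).

(** A superlevel set of positive measure would bound the moments of order p_k
from below by M^p_k times a constant, whereas they grow at most like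
exp (theta^k (y + f)); as p_k grows like theta^k (p0 - crit), this fails for
large k. *)
Lemma moser_bound p0 (s tau y M : R) : 1 <= p0 -> crit < p0 ->
  moment_decay T m theta kappa C0 p0 A ->
  0 <= s -> 0 < tau -> ((s + tau)%:E < T)%E -> 0 < M ->
  (moment mu D p0 (v s) <= (expR y)%:E)%E ->
  y + moser_const m theta kappa C0 p0 - conj_exp theta * ln tau
    < (p0 - crit) * ln M ->
  ess_bounded mu D M (v (s + tau)).
Proof.
move=> p01 critp0 dec s0 tau0 stauT M0 Ay lnM_gt.
have stau0 : 0 <= s + tau by rewrite addr_ge0// ltW.
apply: ess_bounded_null => //; first exact: mv.
apply: contrapT => /eqP; set c := mu _ => c_neq0.
have [c' c'0 c'c] : exists2 c' : R, 0 < c' & (c'%:E <= c)%E.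
  have : (0 < c)%E by rewrite lt0e c_neq0 measure_ge0.
  by case: c {c_neq0} => [x x0| _|//]; [exists x|exists 1; rewrite ?leey].
set f := moser_const m theta kappa C0 p0 - conj_exp theta * ln tau.
have bound k : theta ^+ k * ((p0 - crit) * ln M - (y + f)) <=
    - f - ln c' - crit * ln M.
  pose p := moser_exp theta kappa p0 k.
  have p0p : p0 <= p by exact: le_moser_exp.
  have tk : moser_time s tau k <= s + tau.
    by rewrite lerD2l ger_pMr// gerBl exprn_ge0// invr_ge0.
  have tk0 : 0 <= moser_time s tau k.
    rewrite addr_ge0// mulr_ge0 ?(ltW tau0)// subr_ge0 exprn_ile1 ?invr_ge0//.
    by rewrite invf_le1 ?ler1n.
  have : ((M `^ p * c')%:E <= (expR (theta ^+ k * (y + f) - f -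
      conj_exp theta * moser_slope m theta * k%:R))%:E)%E.
    apply: le_trans (moser_iteration T m theta kappa C0 p0 A m1 theta1 C0_gt0
      p01 critp0 _ dec s tau y k s0 tau0 stauT Ay) => /=; last first.
      by move=> *; exact: moment_ge0.
    apply: le_trans (moment_antitone T m theta kappa C0 p0 A C0_gt0 p01
      dec p _ _ p0p tk0 tk stauT).
    apply: le_trans (chebyshev_moment mu D mD p M _ (mv _ stau0 stauT) _ (ltW M0)).
      by rewrite EFinM lee_pmul2l// lte_fin powR_gt0.
    by rewrite (le_trans _ p0p)// (le_trans _ p01).
  rewrite lee_fin -[X in is_true X -> _]ler_ln;
    rewrite ?posrE ?mulr_gt0 ?powR_gt0 ?expR_gt0// expRK.
  rewrite lnM ?posrE ?powR_gt0// ln_powR /p /moser_exp.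
  have : 0 <= conj_exp theta * moser_slope m theta * k%:R.
    have c0 := ltW (conj_exp_gt0 theta theta1).
    have sl0 := moser_slope_ge0 m theta m1 theta1.
    exact: mulr_ge0 (mulr_ge0 c0 sl0) (ler0n _ _).
  by nra.
have D0 : 0 < (p0 - crit) * ln M - (y + f) by rewrite subr_gt0 addrA.
have [k] := exprn_unbounded _ theta ((- f - ln c' - crit * ln M) /
  ((p0 - crit) * ln M - (y + f))) theta1.
by rewrite ltr_pdivrMr// ltNge bound.
Qed.

(** * Extrapolation down to the exponent 1 *)

Section extrapolation.
Variables (rho a : R).
Hypothesis (rho1 : 1 < rho) (crit1 : crit < 1) (a0 : 0 < a).
Hypothesis dec : moment_decay T m theta kappa C0 rho A.
Hypothesis mass : forall t, 0 <= t -> (t%:E < T)%E ->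
  (moment mu D 1 (v t) <= a%:E)%E.

Local Notation k' := (moser_const m theta kappa C0 rho).
Local Notation theta' := (conj_exp theta).
Local Notation w := ((1 - crit)^-1).

(** The bound to be proved, exp H being its constant: t and a occur with the
powers - sigma and varpi for r = 1. *)
Definition profile (H t : R) : R := expR (H - theta' * w * ln t + w * ln a).

(** The fixed point of the affine map sending H to the constant obtained after
one step of [profile_contraction]; the summand 1 makes the hypothesis of
[moser_bound] strict. *)
Definition profile_level : R :=
  (k' + (rho - crit) * (theta' * w * ln 2 + 1)) / (1 - crit).

Let rho_crit : 0 < rho - crit.
Proof. by rewrite subr_gt0 (lt_trans crit1). Qed.

Let one_crit : 0 < 1 - crit. Proof. by rewrite subr_gt0. Qed.

Let crit_rho : crit < rho. Proof. exact: lt_trans crit1 rho1. Qed.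

(** The L^rho to L^oo bound between s / 2 and s, where the L^rho norm at s / 2
is interpolated between the L^oo bound assumed and the mass.  The powers of s
and a are the ones that are reproduced by this step. *)
Lemma profile_contraction H t :
  (forall s, 0 < s -> s <= t -> ess_bounded mu D (profile H s) (v s)) ->
  (t%:E < T)%E ->
  forall s, 0 < s -> s <= t -> ess_bounded mu D (profile
    (profile_level + (rho - 1) / (rho - crit) * (H - profile_level)) s) (v s).
Proof.
move=> vH tT s s0 st.
have h0 : 0 < s / 2 by rewrite divr_gt0.
have hs : s / 2 + s / 2 = s by rewrite -splitr.
have hT : ((s / 2)%:E < T)%E.
  by apply: le_lt_trans tT; rewrite lee_fin (le_trans _ st)// -{2}hs lerDl ltW.
pose y := (rho - 1) * (H - theta' * w * ln (s / 2) + w * ln a) + ln a.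
rewrite -{2}hs; apply: (moser_bound rho (s / 2) (s / 2) y) => //.
- exact: ltW.
- exact: ltW.
- by rewrite hs (le_lt_trans _ tT)// lee_fin.
- exact: expR_gt0.
- apply: le_trans (moment_interpolation mu D mD rho (profile H (s / 2)) _
    (mv _ (ltW h0) hT) (ltW rho1) (expR_ge0 _) _) _.
    by apply: vH => //; rewrite (le_trans _ st)// -{2}hs lerDl ltW.
  rewrite /y expRD lnK ?posrE// (mulrC (rho - 1)) expRM.
  rewrite [leRHS]EFinM lee_pmul2l ?lte_fin ?powR_gt0 ?expR_gt0//.
  by apply: mass => //; exact: ltW.
rewrite expRK lnM ?posrE// lnV ?posrE// -subr_gt0.
rewrite [X in 0 < X](_ : _ = rho - crit)//.
rewrite /y /profile_level lnM ?posrE// lnV ?posrE//.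
by field; rewrite !gt_eqF.
Qed.

(** Near t = 0 the L^rho to L^oo bound is less singular than the profile,
because sigma decreases with the exponent; H may depend on v. *)
Lemma profile_initial t : 0 < t -> (t%:E < T)%E -> (0%:E < T)%E ->
  (moment mu D rho (v 0) < +oo)%E ->
  exists H, forall s, 0 < s -> s <= t -> ess_bounded mu D (profile H s) (v s).
Proof.
move=> t0 tT T0 Moo.
have [b b0 Mb] : exists2 b : R, 0 < b & (moment mu D rho (v 0) <= b%:E)%E.
  have := moment_ge0 mu D rho (v 0); move: Moo.
  case: (moment _ _ _ _) => [x _ x0| |//]; last by rewrite ltxx.
  by exists (x + 1); [rewrite ltr_wpDl|rewrite lee_fin lerDl].
exists ((ln b + k' + (rho - 1) * (theta' * w) * ln t + 1) / (rho - crit)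
  - w * ln a).
move=> s s0 st; rewrite -{2}[s]add0r.
apply: (moser_bound rho 0 s (ln b)) => //.
- exact: ltW.
- by rewrite add0r (le_lt_trans _ tT)// lee_fin.
- exact: expR_gt0.
- by rewrite lnK ?posrE.
have sg0 : 0 <= (rho - 1) * (theta' * w).
  rewrite mulr_ge0 ?subr_ge0 ?(ltW rho1)// mulr_ge0// ltW ?conj_exp_gt0//.
  by rewrite invr_gt0.
have lnst : ln s <= ln t by rewrite ler_ln ?posrE.
have := ler_wpM2l sg0 lnst; rewrite -subr_ge0 => lnst'.
rewrite expRK -subr_gt0.
(* The last summand 1 is the one in the choice of H. *)
rewrite [X in 0 < X](_ : _ = (rho - 1) * (theta' * w) * ln t -
   (rho - 1) * (theta' * w) * ln s + 1); first by rewrite ltr_wpDl.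
by field; rewrite !gt_eqF.
Qed.

(** Iterating the contraction brings H as close to the fixed point as wanted;
distance 1 is enough. *)
Lemma profile_bound t : 0 < t -> (t%:E < T)%E -> (0%:E < T)%E ->
  (moment mu D rho (v 0) < +oo)%E ->
  ess_bounded mu D (profile (profile_level + 1) t) (v t).
Proof.
move=> t0 tT T0 Moo.
have [H vH] := profile_initial t t0 tT T0 Moo.
set e := (rho - 1) / (rho - crit).
have e0 : 0 < e by rewrite divr_gt0// subr_gt0.
have e1 : 1 < e^-1.
  by rewrite invf_gt1// ltr_pdivrMr// mul1r ltrD2l ltrN2.
have iter k s : 0 < s -> s <= t ->
    ess_bounded mu D
      (profile (profile_level + e ^+ k * (H - profile_level)) s) (v s).
  elim: k s => [|k IHk] s s0 st; first by rewrite expr0 mul1r subrKC; exact: vH.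
  have := profile_contraction _ _ IHk tT s s0 st.
  by rewrite addrAC subrr add0r mulrA -exprS.
have [k] := exprn_unbounded _ e^-1 (H - profile_level) e1.
rewrite exprVn -[X in _ < X]mul1r ltr_pdivlMr ?exprn_gt0// mulrC => /ltW Hk.
apply: filterS (iter k t t0 (lexx t)) => x vx Dx.
by apply: le_trans (vx Dx) _; rewrite ler_expR !lerD2r lerD2l.
Qed.

End extrapolation.

End smoothing.

(** * The smoothing estimate *)

Section smoothing_rV.
Context {R : realType} (N : nat).
Variables (Omega : set 'rV[R]_N) (T : \bar R) (m theta lambda C0 : R)
  (v : R -> 'rV[R]_N -> R).
Local Notation mu := (@lebesgue_rV R N).
Local Notation kappa := (m - 1 + lambda).
Local Notation crit := (critical_exp theta kappa).

(** The powers of v and of |v| may differ where v < 0, but only on a null set. *)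
Lemma energy_moment_decay p0 : m != 0 ->
  measurable Omega ->
  (forall t, 0 <= t -> (t%:E < T)%E -> measurable_fun Omega (v t)) ->
  ae_nonneg Omega T v ->
  energy_ineq_above Omega T m theta lambda C0 (p0 - 1) v ->
  moment_decay T m theta kappa C0 p0 (fun p t => moment mu Omega p (v t)).
Proof.
move=> m0 mO mv v0 E s t p s0 st tT p0p.
have t0 : 0 <= t by rewrite (le_trans s0) ?ltW.
have sT : (s%:E < T)%E by rewrite (le_lt_trans _ tT)// lee_fin ltW.
have := E s t (p - 1) s0 st tT; rewrite lerD2r => /(_ p0p).
rewrite /energy_ineq subrK.
rewrite (moment_ae_nonneg mu Omega mO p (v t) (mv _ t0 tT) (v0 _ t0 tT)).
rewrite (moment_ae_nonneg mu Omega mO p (v s) (mv _ s0 sT) (v0 _ s0 sT)).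
have -> : 1 + (p - 1 + lambda) / m = (p + kappa) / m by field.
have -> : (p + kappa) / m * m * theta = theta * (p + kappa) by field.
have -> : (\int[lebesgue_measure]_(tau in `[s, t])
    (\int[mu]_(x in Omega) (v tau x `^ (theta * (p + kappa)))%:E) `^ theta^-1 =
  \int[lebesgue_measure]_(tau in `[s, t])
    moment mu Omega (theta * (p + kappa)) (v tau) `^ theta^-1)%E; last by [].
apply: eq_integral => tau.
rewrite inE/= in_itv/= => /andP[stau taut].
have tau0 : 0 <= tau by exact: le_trans stau.
have tauT : (tau%:E < T)%E by rewrite (le_lt_trans _ tT)// lee_fin.
by rewrite (moment_ae_nonneg mu Omega mO _ _ (mv _ tau0 tauT) (v0 _ tau0 tauT)).
Qed.

Lemma smoothing_exponents r : 1 < theta -> 0 < r -> crit < r ->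
  sigma_exp r m lambda theta = conj_exp theta * (r - crit)^-1 /\
  varpi_exp r m lambda theta = r * (r - crit)^-1.
Proof.
move=> theta1 r0 rcrit.
have c0 := conj_exp_gt0 theta theta1.
have rc0 : 0 < r - crit by rewrite subr_gt0.
have sE : sigma_exp r m lambda theta = conj_exp theta * (r - crit)^-1.
  have e : r - crit = (r / conj_exp theta + lambda + m - 1) * conj_exp theta.
    by rewrite /critical_exp; field; rewrite gt_eqF.
  by rewrite e invfM mulrA mulrAC mulfV ?mul1r// gt_eqF.
split=> //; rewrite /varpi_exp sE.
by field; rewrite !gt_eqF.
Qed.

End smoothing_rV.

Lemma measurable_domain (R : realType) N (Omega : set 'rV[R]_N) :
  Omega = setT \/ smooth_bounded_domain Omega -> measurable Omega.
Proof.
by case=> [->|[oO _ _ _ _]]; [exact: measurableT|exact: open_measurable_rV].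
Qed.

Theorem lemma2p1 (R : realType) (N : nat) (m theta lambda C0 r : R)
    (hN : (0 < N)%N) (hm : 1 < m) (htheta : 1 < theta) (hC0 : 0 < C0)
    (hr : 1 <= r) (hrbig : conj_exp theta * (1 - m - lambda) < r) :
  (* r > 1, or r = 1 under (H1): the constant does not involve rho *)
  (exists C : R, 0 < C /\
    forall (Omega : set 'rV[R]_N) (T : \bar R) (v : R -> 'rV[R]_N -> R),
      (Omega = setT \/ smooth_bounded_domain Omega) ->
      (0 < T)%E ->
      continuous_L1loc Omega T v ->
      ae_nonneg Omega T v ->
      in_Lp Omega r%:E (v 0) ->
      (1 < r /\ energy_ineq_above Omega T m theta lambda C0 (r - 1) v) \/
      (r = 1 /\ energy_ineq_above Omega T m theta lambda C0 0 v) ->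
      smoothing_estimate Omega T m theta lambda r C v)
  /\
  (* r = 1 under (H2): the constant may also depend on rho *)
  (forall rho : R, r = 1 -> 1 < rho ->
    rho * conj_exp theta * (1 - m - lambda) < 1 ->
    exists C : R, 0 < C /\
    forall (Omega : set 'rV[R]_N) (T : \bar R) (v : R -> 'rV[R]_N -> R),
      (Omega = setT \/ smooth_bounded_domain Omega) ->
      (0 < T)%E ->
      continuous_L1loc Omega T v ->
      ae_nonneg Omega T v ->
      in_Lp Omega r%:E (v 0) ->
      (forall t : R, 0 < t -> (t%:E < T)%E ->
        (\int[lebesgue_rV N]_(x in Omega) (v t x)%:E <=
         \int[lebesgue_rV N]_(x in Omega) (v 0%R x)%:E)%E) ->
      in_Lp Omega rho%:E (v 0) ->
      energy_ineq_above Omega T m theta lambda C0 (rho - 1) v ->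
      smoothing_estimate Omega T m theta lambda r C v).
Proof.
have m0 : m != 0 by rewrite gt_eqF// (lt_trans _ hm).
have critE : critical_exp theta (m - 1 + lambda) =
    conj_exp theta * (1 - m - lambda).
  by rewrite /critical_exp; ring.
have r0 : 0 < r by exact: lt_le_trans hr.
have crit_r : critical_exp theta (m - 1 + lambda) < r by rewrite critE.
have [sE wE] := smoothing_exponents m theta lambda r htheta r0 crit_r.
have rc0 : 0 < r - critical_exp theta (m - 1 + lambda) by rewrite subr_gt0.
split.
  exists (expR ((moser_const m theta (m - 1 + lambda) C0 r + 1) /
    (r - critical_exp theta (m - 1 + lambda)))).
  split=> [|Omega T v hO T0 cv v0 [mv0 v0r] E t t0 tT]; first exact: expR_gt0.
  have mO := measurable_domain _ _ _ hO.
  have mv s : 0 <= s -> (s%:E < T)%E -> measurable_fun Omega (v s).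
    by move=> s0 sT; case: (cv s s0 sT) => -[].
  have dec : moment_decay T m theta (m - 1 + lambda) C0 r
      (fun p t => moment (lebesgue_rV N) Omega p (v t)).
    apply: energy_moment_decay => //.
    by case: E => -[]// -> E1; rewrite subrr.
  rewrite sE wE; apply: Lnorm_oo_le_power => //.
  - by rewrite mulr_gt0 ?expR_gt0 ?powR_gt0.
  - by rewrite invr_gt0.
  - by rewrite -Lnorm_moment// poweR_lty.
  move=> a a0 Ma; rewrite -[t in v t]add0r.
  apply: (moser_bound (lebesgue_rV N) Omega mO T m theta (m - 1 + lambda) C0 v
    hm htheta hC0 mv r 0 t (ln a)) => //.
  - by rewrite add0r.
  - by rewrite !mulr_gt0 ?expR_gt0 ?powR_gt0.
  - by rewrite lnK ?posrE.
  rewrite !lnM ?posrE ?mulr_gt0 ?expR_gt0 ?powR_gt0// !ln_powR expRK -subr_gt0.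
  by rewrite [X in 0 < X](_ : _ = 1)//; field; rewrite gt_eqF.
move=> rho r1 rho1 hrho; subst r.
exists (expR (profile_level m theta (m - 1 + lambda) C0 rho + 1)).
split=> [|Omega T v hO T0 cv v0 [mv0 v01] mass [_ v0rho] E t t0 tT].
  exact: expR_gt0.
have mO := measurable_domain _ _ _ hO.
have mv s : 0 <= s -> (s%:E < T)%E -> measurable_fun Omega (v s).
  by move=> s0 sT; case: (cv s s0 sT) => -[].
have dec : moment_decay T m theta (m - 1 + lambda) C0 rho
    (fun p t => moment (lebesgue_rV N) Omega p (v t)).
  exact: energy_moment_decay.
have rho0 : 0 < rho by exact: lt_trans rho1.
have mass1 s : 0 <= s -> (s%:E < T)%E ->
    (\int[lebesgue_rV N]_(x in Omega) (v s x)%:E)%E =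
    moment (lebesgue_rV N) Omega 1 (v s).
  move=> s0 sT; apply: ae_eq_integral => //.
  - by apply/measurable_EFinP; exact: mv.
  - by apply: measurable_moment; exact: mv.
  - by apply: filterS (v0 s s0 sT) => x vx Dx; rewrite powRr1// ger0_norm// vx.
rewrite sE wE; apply: Lnorm_oo_le_power => //.
- by rewrite mulr_gt0 ?expR_gt0 ?powR_gt0.
- by rewrite invr_gt0.
- by rewrite -Lnorm_moment// poweR_lty.
move=> a a0 Ma.
have -> : expR (profile_level m theta (m - 1 + lambda) C0 rho + 1) *
    t `^ (- (conj_exp theta * (1 - critical_exp theta (m - 1 + lambda))^-1)) *
    a `^ (1 - critical_exp theta (m - 1 + lambda))^-1 =
    profile theta (m - 1 + lambda) a
      (profile_level m theta (m - 1 + lambda) C0 rho + 1) t.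
  have powE x y : 0 < x -> x `^ y = expR (y * ln x).
    by move=> x0; rewrite mulrC expRM lnK.
  by rewrite !powE// /profile -!expRD mulNr.
apply: (profile_bound _ _ mO T _ _ _ C0) => //.
- move=> s; rewrite le_eqVlt => /predU1P[<- _//|s0 sT].
  rewrite -mass1 ?(ltW s0)//; apply: le_trans (mass s s0 sT) _.
  by rewrite mass1.
- by rewrite -Lnorm_moment// poweR_lty.
Qed.
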